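(* Let $\mu>0$, $p\in(0,1]$, and let $\mathcal{B}_\mu$ be the collection of all $\{0,1,2,\dots\}$-valued random variables $D$ with $\mathbb{E}(D)=\mu$. Let $q^*=\inf_{D\in\mathcal{B}_\mu}q_{D,p}$. Then there exist $k\in\mathbb{N}$ and $D^*\in\mathcal{B}_\mu$ with $$\mathbb{P}(D^*=0)+\mathbb{P}(D^*=k)+\mathbb{P}(D^*=k+1)=1$$ such that $q_{D^*,p}=q^*$.
   Context: For an $\{0,1,2,\dots\}$-valued $D$ with $0<\mu_D=\mathbb{E}(D)<\infty$: $f_D(s)=\mathbb{E}(s^D)$, $\bar f_D(s)=f_D'(s)/\mu_D$ for $s\in[0,1]$. For $p\in(0,1]$ (thinning parameter: in the configuration model with i.i.d. degrees distributed as $D$, each edge is kept independently with probability $p$), set $g_{D,p}(s)=f_D(1-p+ps)$ and $\bar g_{D,p}(s)=\bar f_D(1-p+ps)$. $z_{D,p}$ is the smallest root in $[0,1]$ of $s=\bar g_{D,p}(s)$ and $q_{D,p}:=g_{D,p}(z_{D,p})$. ($1-q_{D,p}$ is the limiting fraction of vertices in the largest component of the thinned configuration model.) $\mathbb{N}=\{1,2,\dots\}$. *)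

(* Defs.v *)
From Stdlib Require Import Reals ClassicalEpsilon.
Open Scope R_scope.

(* Value of a convergent real series (chosen classically; unique when it exists). *)
Definition series (a : nat -> R) : R :=
  epsilon (inhabits 0) (fun l => infinite_sum a l).

(* A {0,1,2,...}-valued random variable D is represented by its law
   P n = P(D = n). *)
Definition is_pmf (P : nat -> R) : Prop :=
  (forall n, 0 <= P n) /\ infinite_sum P 1.

Definition in_B (mu : R) (P : nat -> R) : Prop :=
  is_pmf P /\ infinite_sum (fun n => INR n * P n) mu.

Definition meanD (P : nat -> R) : R := series (fun n => INR n * P n).

Definition fD (P : nat -> R) (s : R) : R := series (fun n => P n * s ^ n).

Definition fD' (P : nat -> R) (s : R) : R :=
  series (fun n => INR (S n) * P (S n) * s ^ n).
Definition fbarD (P : nat -> R) (s : R) : R := fD' P s / meanD P.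

Definition gDp (P : nat -> R) (p s : R) : R := fD P (1 - p + p * s).
Definition gbarDp (P : nat -> R) (p s : R) : R := fbarD P (1 - p + p * s).

Definition is_smallest_root (P : nat -> R) (p z : R) : Prop :=
  0 <= z <= 1 /\ gbarDp P p z = z /\
  (forall s, 0 <= s <= 1 -> gbarDp P p s = s -> z <= s).

Definition zDp (P : nat -> R) (p : R) : R :=
  epsilon (inhabits 0) (is_smallest_root P p).

Definition qDp (P : nat -> R) (p : R) : R := gDp P p (zDp P p).

(* Main.v *)
(* Put t = 1 - p + p z_D and let N be the size-biased version of D. Then
   E(t^(N-1)) = z_D and q_D = 1 - mu E((1 - t^N)/N), and (1 - t^n)/n is a concave
   function of t^n. Replacing N by the N' on two consecutive integers with the same
   E(t^N) thus lowers f_D(t) while keeping the fixed point, so q does not increase.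
   This N' comes from a law with P(D = 0) >= 0 unless mu E(1/N') > 1; in that case
   the law on the integers around mu does the job, by convexity of n |-> t^n and
   because 1/n and t^n are monotone along laws on two consecutive integers.
   The minimum over the laws on {0, k, k+1} is attained since q is lower
   semicontinuous on the compact segment of laws for each k, and q >= 1 - mu/k. *)
Require Import Defs.
From Stdlib Require Import Reals ClassicalEpsilon.
From Stdlib Require Import Lra Lia.
From Coquelicot Require Import Coquelicot.
Open Scope R_scope.

(** * Sums of real series *)

Lemma infinite_sum_series (a : nat -> R) (l : R) : infinite_sum a l -> series a = l.
Proof.
  intros H; unfold series.
  apply (uniqueness_sum a); [|exact H].
  apply (epsilon_spec (inhabits 0) (fun l => infinite_sum a l)); now exists l.
Qed.

Lemma infinite_sum_ext (a b : nat -> R) (l : R) :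
  (forall n, a n = b n) -> infinite_sum a l -> infinite_sum b l.
Proof.
  intros E H; apply is_series_Reals; apply is_series_ext with a; [exact E|].
  now apply is_series_Reals.
Qed.

Lemma infinite_sum_plus (a b : nat -> R) (l m : R) :
  infinite_sum a l -> infinite_sum b m -> infinite_sum (fun n => a n + b n) (l + m).
Proof.
  intros Ha Hb; apply is_series_Reals in Ha; apply is_series_Reals in Hb.
  apply is_series_Reals; exact (is_series_plus a b l m Ha Hb).
Qed.

Lemma infinite_sum_scal (c : R) (a : nat -> R) (l : R) :
  infinite_sum a l -> infinite_sum (fun n => c * a n) (c * l).
Proof.
  intros Ha; apply is_series_Reals in Ha.
  apply is_series_Reals; exact (is_series_scal_l c a l Ha).
Qed.

Lemma infinite_sum_le (a b : nat -> R) (l m : R) :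
  (forall n, a n <= b n) -> infinite_sum a l -> infinite_sum b m -> l <= m.
Proof.
  intros Hab Ha Hb; apply is_series_Reals in Ha; apply is_series_Reals in Hb.
  apply (is_lim_seq_le (sum_n a) (sum_n b) l m); [|exact Ha|exact Hb].
  intros n; apply sum_n_m_le; exact Hab.
Qed.

Lemma infinite_sum_single (k : nat) (c : R) :
  infinite_sum (fun n => if Nat.eqb n k then c else 0) c.
Proof.
  intros eps Heps; exists k; intros n Hn.
  replace (sum_f_R0 (fun n => if Nat.eqb n k then c else 0) n) with c.
  { unfold Rdist; rewrite Rminus_diag, Rabs_R0; exact Heps. }
  assert (E : forall m, sum_f_R0 (fun n => if Nat.eqb n k then c else 0) m
                        = if Nat.leb k m then c else 0).
  { induction m as [|m IH].
    - simpl; destruct k; reflexivity.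
    - rewrite tech5, IH.
      destruct (Nat.leb_spec k m), (Nat.eqb_spec (S m) k), (Nat.leb_spec k (S m));
        try lia; lra. }
  rewrite E; destruct (Nat.leb_spec k n); [reflexivity|lia].
Qed.

Lemma term_le_infinite_sum (a : nat -> R) (l : R) (k : nat) :
  (forall n, 0 <= a n) -> infinite_sum a l -> a k <= l.
Proof.
  intros Ha Hl.
  apply (infinite_sum_le (fun n => if Nat.eqb n k then a k else 0) a); auto.
  - intros n; destruct (Nat.eqb_spec n k) as [->|]; [lra|apply Ha].
  - apply infinite_sum_single.
Qed.

Lemma infinite_sum_dominated (a b : nat -> R) (l : R) :
  (forall n, 0 <= a n <= b n) -> infinite_sum b l -> exists m, infinite_sum a m.
Proof.
  intros Hab Hb; apply is_series_Reals in Hb.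
  destruct (ex_series_le a b) as [m Hm].
  - intros n; change (Rabs (a n) <= b n); rewrite Rabs_pos_eq; apply Hab.
  - now exists l.
  - exists m; now apply is_series_Reals.
Qed.

Lemma infinite_sum_shift (a : nat -> R) (l : R) :
  a 0%nat = 0 -> infinite_sum a l -> infinite_sum (fun n => a (S n)) l.
Proof.
  intros H0 H; apply is_series_Reals; apply is_series_incr_1.
  apply is_series_Reals; rewrite H0; unfold plus; simpl; now rewrite Rplus_0_r.
Qed.

Lemma pow_unit (t : R) (n : nat) : 0 <= t <= 1 -> 0 <= t ^ n <= 1.
Proof.
  intros H; split; [apply pow_le; lra|].
  rewrite <- (pow1 n); apply pow_incr; lra.
Qed.

(** * Generating functions of a law with mean [mu], and the smallest root *)

Section Law.

Variables (mu : R) (P : nat -> R).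
Hypotheses (hmu : 0 < mu) (HP : in_B mu P).

Lemma law_nonneg (n : nat) : 0 <= P n.
Proof. apply HP. Qed.

Lemma weight_nonneg (n : nat) : 0 <= INR n * P n.
Proof. apply Rmult_le_pos; [apply pos_INR|apply law_nonneg]. Qed.

Lemma meanD_in_B : meanD P = mu.
Proof. apply infinite_sum_series, HP. Qed.

Lemma fD_sum (t : R) : 0 <= t <= 1 -> infinite_sum (fun n => P n * t ^ n) (fD P t).
Proof.
  intros Ht.
  destruct (infinite_sum_dominated (fun n => P n * t ^ n) P 1) as [m Hm].
  - intros n; generalize (pow_unit t n Ht) (law_nonneg n); split; nra.
  - apply HP.
  - unfold fD; now rewrite (infinite_sum_series _ _ Hm).
Qed.

Lemma fD'_sum (t : R) : 0 <= t <= 1 ->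
  infinite_sum (fun n => INR n * P n * t ^ pred n) (fD' P t).
Proof.
  intros Ht.
  destruct (infinite_sum_dominated (fun n => INR n * P n * t ^ pred n)
              (fun n => INR n * P n) mu) as [m Hm].
  - intros n; generalize (pow_unit t (pred n) Ht) (weight_nonneg n); split; nra.
  - apply HP.
  - unfold fD'; rewrite (infinite_sum_series _ m); [exact Hm|].
    apply (infinite_sum_shift _ _) in Hm; [exact Hm|simpl; ring].
Qed.

Lemma fD_one : fD P 1 = 1.
Proof.
  apply (uniqueness_sum (fun n => P n * 1 ^ n)).
  - apply fD_sum; lra.
  - apply (infinite_sum_ext P); [intros n; rewrite pow1; ring|apply HP].
Qed.

Lemma fD'_one : fD' P 1 = mu.
Proof.
  apply (uniqueness_sum (fun n => INR n * P n * 1 ^ pred n)).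
  - apply fD'_sum; lra.
  - apply (infinite_sum_ext (fun n => INR n * P n)); [intros n; rewrite pow1; ring|apply HP].
Qed.

Lemma fD_incr (s t : R) : 0 <= s -> s <= t -> t <= 1 -> fD P s <= fD P t.
Proof.
  intros H0 Hst H1.
  apply (infinite_sum_le (fun n => P n * s ^ n) (fun n => P n * t ^ n));
    [|apply fD_sum; lra|apply fD_sum; lra].
  intros n; apply Rmult_le_compat_l; [apply law_nonneg|apply pow_incr; lra].
Qed.

Lemma fbarD_incr (s t : R) : 0 <= s -> s <= t -> t <= 1 -> fbarD P s <= fbarD P t.
Proof.
  intros H0 Hst H1; unfold fbarD; rewrite meanD_in_B.
  apply Rmult_le_compat_r; [left; now apply Rinv_0_lt_compat|].
  apply (infinite_sum_le (fun n => INR n * P n * s ^ pred n)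
           (fun n => INR n * P n * t ^ pred n));
    [|apply fD'_sum; lra|apply fD'_sum; lra].
  intros n; apply Rmult_le_compat_l; [apply weight_nonneg|apply pow_incr; lra].
Qed.

Lemma fbarD_one : fbarD P 1 = 1.
Proof. unfold fbarD; rewrite meanD_in_B, fD'_one; field; lra. Qed.

Lemma fbarD_zero_nonneg : 0 <= fbarD P 0.
Proof.
  unfold fbarD; rewrite meanD_in_B.
  apply Rmult_le_pos; [|left; now apply Rinv_0_lt_compat].
  apply Rle_trans with (INR 0 * P 0%nat * 0 ^ pred 0); [simpl; lra|].
  apply (term_le_infinite_sum (fun n => INR n * P n * 0 ^ pred n)).
  - intros n; apply Rmult_le_pos; [apply weight_nonneg|apply pow_le; lra].
  - apply fD'_sum; lra.
Qed.

(** If the derivative vanished at some t > 0, every term n P n would be 0 and so would the mean.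
    This makes the root positive whenever t > 0. *)
Lemma fbarD_pos (t : R) : 0 < t <= 1 -> 0 < fbarD P t.
Proof.
  intros Ht.
  assert (Hf : 0 <= fbarD P t).
  { apply Rle_trans with (fbarD P 0); [apply fbarD_zero_nonneg|apply fbarD_incr; lra]. }
  destruct Hf as [Hf|Hf]; [exact Hf|exfalso].
  assert (E : fD' P t = 0).
  { unfold fbarD in Hf; rewrite meanD_in_B in Hf.
    apply (Rmult_eq_reg_r (/ mu)); [lra|apply Rinv_neq_0_compat; lra]. }
  assert (Hz : forall n, INR n * P n = 0).
  { intros n.
    assert (Hn : INR n * P n * t ^ pred n <= 0).
    { rewrite <- E.
      apply (term_le_infinite_sum (fun n => INR n * P n * t ^ pred n)).
      - intros m; apply Rmult_le_pos; [apply weight_nonneg|apply pow_le; lra].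
      - apply fD'_sum; lra. }
    assert (0 < t ^ pred n) by (apply pow_lt; lra).
    generalize (weight_nonneg n); nra. }
  assert (mu <= 0); [|lra].
  apply (infinite_sum_le (fun n => INR n * P n) (fun n => if Nat.eqb n 0 then 0 else 0)).
  - intros n; rewrite Hz; destruct (Nat.eqb n 0); lra.
  - apply HP.
  - apply infinite_sum_single.
Qed.

Variable p : R.
Hypothesis hp : 0 < p <= 1.

(* Knaster-Tarski: the infimum of the points with [gbar s <= s] is a fixed point,
   so no continuity of [gbar] is needed. *)
Lemma smallest_root_exists : exists z,
  is_smallest_root P p z /\ forall s, 0 <= s <= 1 -> gbarDp P p s <= s -> z <= s.
Proof.
  (* Points are stored with opposite sign, because [completeness] provides suprema; the infimum
     sought is [- m]. *)
  set (E := fun x => 0 <= - x <= 1 /\ gbarDp P p (- x) <= - x).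
  assert (E1 : E (-1)).
  { unfold E, gbarDp; split; [lra|].
    replace (1 - p + p * - -1) with 1 by ring; rewrite fbarD_one; lra. }
  destruct (completeness E) as [m [Hub Hlub]].
  { exists 0; intros x [Hx _]; lra. }
  { now exists (-1). }
  set (z := - m).
  assert (Hz : forall s, 0 <= s <= 1 -> gbarDp P p s <= s -> z <= s).
  { intros s Hs Hg; unfold z.
    assert (- s <= m); [|lra].
    apply Hub; unfold E; rewrite Ropp_involutive; auto. }
  assert (Hz01 : 0 <= z <= 1).
  { split.
    - assert (m <= 0); [|unfold z; lra].
      apply Hlub; intros x [Hx _]; lra.
    - assert (- 1 <= m); [|unfold z; lra]. now apply Hub. }
  assert (Hmono : forall s s', 0 <= s -> s <= s' -> s' <= 1 ->
                    gbarDp P p s <= gbarDp P p s').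
  { intros s s' ? ? ?; unfold gbarDp; apply fbarD_incr; nra. }
  assert (Hle : gbarDp P p z <= z).
  (* By monotonicity gbar z <= gbar s <= s for each admissible s, so gbar z is a lower bound of
     them. *)
  { assert (m <= - gbarDp P p z); [|unfold z in *; lra].
    apply Hlub; intros x [Hx Hg].
    assert (z <= - x) by now apply Hz.
    assert (gbarDp P p z <= gbarDp P p (- x)) by (apply Hmono; lra).
    lra. }
  assert (Hg0 : 0 <= gbarDp P p z).
  { apply Rle_trans with (fbarD P 0); [apply fbarD_zero_nonneg|].
    unfold gbarDp; apply fbarD_incr; nra. }
  exists z; split; [|exact Hz].
  split; [exact Hz01|split].
  - apply Rle_antisym; [exact Hle|].
    apply Hz; [lra|apply Hmono; lra].
  - intros s Hs Hg; apply Hz; [exact Hs|lra].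
Qed.

Lemma zDp_smallest_root : is_smallest_root P p (zDp P p).
Proof.
  apply (epsilon_spec (inhabits 0) (is_smallest_root P p)).
  destruct smallest_root_exists as [z [Hz _]]; now exists z.
Qed.

Lemma zDp_le (s : R) : 0 <= s <= 1 -> gbarDp P p s <= s -> zDp P p <= s.
Proof.
  intros Hs Hg.
  destruct smallest_root_exists as [z [[Hz01 [Hz _]] Hmin]].
  destruct zDp_smallest_root as [_ [_ H]].
  apply Rle_trans with z; [now apply H|now apply Hmin].
Qed.

(** The source of the upper bounds on q: to compare two laws it suffices to test one of them at the
    root of the other, where only an inequality has to hold. *)
Lemma qDp_le (s : R) : 0 <= s <= 1 -> gbarDp P p s <= s -> qDp P p <= gDp P p s.
Proof.
  intros Hs Hg; unfold qDp, gDp.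
  assert (zDp P p <= s) by now apply zDp_le.
  destruct zDp_smallest_root as [Hz _].
  apply fD_incr; nra.
Qed.

Lemma qDp_le_one : qDp P p <= 1.
Proof.
  replace 1 with (gDp P p 1).
  - apply qDp_le; [lra|]; unfold gbarDp.
    replace (1 - p + p * 1) with 1 by ring; rewrite fbarD_one; lra.
  - unfold gDp; replace (1 - p + p * 1) with 1 by ring; apply fD_one.
Qed.

End Law.

(** * Inequalities for t^n and (1 - t^n)/n *)

Lemma bernoulli_le (t : R) (n : nat) : 0 <= t <= 1 -> 1 + INR n * (t - 1) <= t ^ n.
Proof.
  intros Ht; induction n as [|n IH]; [simpl; lra|].
  rewrite S_INR; simpl pow.
  assert (t * (1 + INR n * (t - 1)) <= t * t ^ n) by (apply Rmult_le_compat_l; lra).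
  assert (0 <= INR n * ((1 - t) * (1 - t)))
    by (apply Rmult_le_pos; [apply pos_INR|apply Rmult_le_pos; lra]).
  lra.
Qed.

(** Bernoulli's inequality for negative exponents, 1 + n (1 - t) <= t^(-n), written without division
    so that it covers t = 0. *)
Lemma one_add_mul_pow_le (t : R) (n : nat) : 0 <= t <= 1 ->
  t ^ n * (1 + INR n * (1 - t)) <= 1.
Proof.
  intros Ht; induction n as [|n IH]; [simpl; lra|].
  rewrite S_INR; simpl pow.
  apply Rle_trans with (2 := IH).
  generalize (pow_unit t n Ht) (pos_INR n); intros Hp Hn.
  assert (t * (1 + (INR n + 1) * (1 - t)) <= 1 + INR n * (1 - t)).
  { assert (0 <= (1 - t) * ((INR n + 1) * (1 - t))); [|lra].
    apply Rmult_le_pos; [lra|apply Rmult_le_pos; lra]. }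
  apply Rle_trans with (t ^ n * (t * (1 + (INR n + 1) * (1 - t)))); [right; ring|].
  apply Rmult_le_compat_l; lra.
Qed.

(** Convexity of n |-> t^n: the line through k and k + 1 stays below at every integer. Bernoulli's
    inequality gives the right side, its negative-exponent form the left. *)
Lemma pow_ge_chord (t : R) (k n : nat) : 0 <= t <= 1 ->
  t ^ k + (INR n - INR k) * (t ^ S k - t ^ k) <= t ^ n.
Proof.
  intros Ht; destruct (Nat.le_gt_cases k n) as [Hkn|Hkn].
  - replace n with (k + (n - k))%nat by lia; set (m := (n - k)%nat).
    rewrite plus_INR, pow_add; simpl pow.
    generalize (bernoulli_le t m Ht) (pow_unit t k Ht); intros Hb Hk; nra.
  - replace k with (n + (k - n))%nat by lia; set (m := (k - n)%nat).
    rewrite plus_INR; simpl pow; rewrite pow_add.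
    generalize (one_add_mul_pow_le t m Ht) (pow_unit t n Ht); intros Hb Hk.
    assert (t ^ n * (t ^ m * (1 + INR m * (1 - t))) <= t ^ n * 1)
      by (apply Rmult_le_compat_l; lra).
    lra.
Qed.

(** The quantity (1 - t^N)/N with N = n + 1, which is the integral of s^n over [t, 1]. The index is
    the exponent n = N - 1 occurring in fbar. *)
Definition hcoef (t : R) (n : nat) : R := (1 - t ^ S n) / INR (S n).

Lemma hcoef_unit (t : R) (n : nat) : 0 <= t <= 1 -> 0 <= hcoef t n <= 1.
Proof.
  intros Ht; unfold hcoef; generalize (pow_unit t (S n) Ht); intros Hp.
  assert (1 <= INR (S n)) by (rewrite S_INR; generalize (pos_INR n); lra).
  split.
  - apply Rmult_le_pos; [lra|left; apply Rinv_0_lt_compat; lra].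
  - apply Rmult_le_reg_r with (INR (S n)); [lra|].
    unfold Rdiv; rewrite Rmult_assoc, Rinv_l; lra.
Qed.

(** Writing e(n) for this expression, e(n+1) = t e(n) + (1 - t) (n + 1 - (n + 2) t + t^(n+2)), and
    the last factor is nonnegative by Bernoulli. *)
Lemma hcoef_drop_num_nonneg (t : R) (n : nat) : 0 <= t <= 1 ->
  0 <= INR n - (INR n + 2) * t + (INR n + 2) * t ^ S n - INR n * t ^ S (S n).
Proof.
  intros Ht; induction n as [|n IH]; [simpl; lra|].
  rewrite S_INR.
  generalize (bernoulli_le t (S (S n)) Ht) (pow_unit t (S n) Ht); rewrite !S_INR.
  intros Hb Hp; simpl pow in *; set (x := t * t ^ n) in *.
  assert (0 <= (1 - t) * (INR n + 1 - (INR n + 2) * t + t * x))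
    by (apply Rmult_le_pos; lra).
  assert (0 <= t * (INR n - (INR n + 2) * t + (INR n + 2) * x - INR n * (t * x)))
    by (apply Rmult_le_pos; lra).
  lra.
Qed.

(** Consecutive drops of t^n have ratio t, so this says that the slopes of [hcoef t n] against t^n
    grow as t^n decreases: concavity in t^n. *)
Lemma hcoef_drop_ratio (t : R) (n : nat) : 0 <= t <= 1 ->
  t * (hcoef t n - hcoef t (S n)) <= hcoef t (S n) - hcoef t (S (S n)).
Proof.
  intros Ht; unfold hcoef.
  generalize (hcoef_drop_num_nonneg t (S n) Ht) (pos_INR n); rewrite !S_INR; intros He Hn.
  apply Rminus_le_0; simpl pow in *; set (x := t ^ n) in *; set (a := INR n) in *.
  replace (_ - _) with ((a + 1 - (a + 1 + 2) * t + (a + 1 + 2) * (t * (t * x))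
     - (a + 1) * (t * (t * (t * x)))) / ((a + 1) * (a + 1 + 1) * (a + 1 + 1 + 1)))
    by (field; repeat split; lra).
  apply Rmult_le_pos; [exact He|left; apply Rinv_0_lt_compat].
  repeat apply Rmult_lt_0_compat; lra.
Qed.

Lemma hcoef_drop_ratio_pow (t : R) (n i : nat) : 0 <= t <= 1 ->
  t ^ i * (hcoef t n - hcoef t (S n)) <= hcoef t (n + i) - hcoef t (S (n + i)).
Proof.
  intros Ht; induction i as [|i IH].
  - rewrite Nat.add_0_r; simpl; lra.
  - rewrite Nat.add_succ_r.
    apply Rle_trans with (2 := hcoef_drop_ratio t (n + i) Ht).
    simpl pow; rewrite Rmult_assoc; apply Rmult_le_compat_l; lra.
Qed.

(* With x = t^(n+1), [hcoef t n] is a multiple of the logarithmic mean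
   (x - 1) / ln x, which is concave in x. The hypothesis [0 < t ^ j] allows
   [t = 0] when [j = 0]. *)
Lemma hcoef_le_chord (t : R) (j : nat) : 0 <= t < 1 -> 0 < t ^ j ->
  exists A B,
    hcoef t j = A + B * t ^ j /\ hcoef t (S j) = A + B * t ^ S j /\
    forall n, hcoef t n <= A + B * t ^ n.
Proof.
  intros Ht Hj; assert (Ht1 : 0 <= t <= 1) by lra.
  (* Slope and intercept of the line through the points of index j and j + 1. *)
  set (B := (hcoef t j - hcoef t (S j)) / (t ^ j - t ^ S j)).
  set (A := hcoef t j - B * t ^ j).
  assert (HB : hcoef t j - hcoef t (S j) = B * (t ^ j * (1 - t))).
  { unfold B; simpl pow; field; nra. }
  assert (Ej : hcoef t j = A + B * t ^ j) by (unfold A; ring).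
  exists A, B; split; [exact Ej|split].
  { simpl pow; lra. }
  intros n; destruct (Nat.le_gt_cases j n) as [Hn|Hn].
  - replace n with (j + (n - j))%nat by lia; generalize (n - j)%nat; clear n Hn.
    induction n as [|n IH]; [rewrite Nat.add_0_r; lra|].
    generalize (hcoef_drop_ratio_pow t j n Ht1); rewrite HB, Nat.add_succ_r.
    simpl pow; rewrite pow_add in *; lra.
  (* Below j the induction descends; the comparison of drops carries the factor t^(i+1), which can
     be cancelled because it divides t^j > 0. *)
  - destruct (Nat.le_exists_sub n j) as [i [Hi _]]; [lia|]; clear Hn.
    rewrite Nat.add_comm in Hi; revert n Hi.
    induction i as [|i IH]; intros n Hi.
    { rewrite Nat.add_0_r in Hi; subst n; lra. }
    assert (IHn : hcoef t (S n) <= A + B * t ^ S n) by (apply IH; lia).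
    assert (Ep : t ^ j = t ^ n * t ^ S i) by (rewrite Hi, pow_add; ring).
    assert (Hpi : 0 < t ^ S i).
    { destruct (proj1 (pow_unit t (S i) Ht1)) as [Hp|Hp]; [exact Hp|].
      rewrite <- Hp in Ep; lra. }
    generalize (hcoef_drop_ratio_pow t n (S i) Ht1); rewrite <- Hi, HB, Ep; intros Hd.
    assert (hcoef t n - hcoef t (S n) <= B * (t ^ n * (1 - t))).
    { apply Rmult_le_reg_l with (t ^ S i); [exact Hpi|lra]. }
    simpl pow in IHn; lra.
Qed.

(** * Laws on {0, j+1, j+2} *)

Definition inv_mean (j : nat) (w : R) : R := w / INR (S j) + (1 - w) / INR (S (S j)).

(* The law on {0, j+1, j+2} with mean [mu] whose size-biased version
   [n P n / mu] puts mass [w] on j+1 and [1 - w] on j+2; [inv_mean j w] is the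
   size-biased mean of 1/n, so the mass at 0 is [1 - mu * inv_mean j w]. *)
Definition three (mu : R) (j : nat) (w : R) (n : nat) : R :=
  (if Nat.eqb n 0 then 1 - mu * inv_mean j w else 0)
  + (if Nat.eqb n (S j) then mu * w / INR (S j) else 0)
  + (if Nat.eqb n (S (S j)) then mu * (1 - w) / INR (S (S j)) else 0).

(** The second inequality says that the mass at 0 is nonnegative. *)
Definition feasible (mu : R) (j : nat) (w : R) : Prop :=
  0 <= w <= 1 /\ mu * inv_mean j w <= 1.

Lemma INR_S_pos (n : nat) : 0 < INR (S n).
Proof. apply lt_0_INR; lia. Qed.

Lemma three_sum (mu w : R) (j : nat) (F : nat -> R) :
  infinite_sum (fun n => three mu j w n * F n)
    ((1 - mu * inv_mean j w) * F 0%nat + mu * w / INR (S j) * F (S j)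
     + mu * (1 - w) / INR (S (S j)) * F (S (S j))).
Proof.
  eapply infinite_sum_ext; [|apply infinite_sum_plus; [apply infinite_sum_plus|];
    [apply (infinite_sum_single 0)|apply (infinite_sum_single (S j))
    |apply (infinite_sum_single (S (S j)))]].
  intros n; unfold three.
  destruct (Nat.eqb_spec n 0) as [H0|], (Nat.eqb_spec n (S j)) as [H1|],
    (Nat.eqb_spec n (S (S j))) as [H2|];
    try lia; rewrite ?H0, ?H1, ?H2; ring.
Qed.

(** The mass at 0 absorbs the terms in 1/n, which leaves 1 minus mu times the size-biased mean of (1
    - t^N)/N. *)
Lemma fD_three (mu w t : R) (j : nat) :
  fD (three mu j w) t = 1 - mu * (w * hcoef t j + (1 - w) * hcoef t (S j)).
Proof.
  unfold fD; rewrite (infinite_sum_series _ _ (three_sum mu w j (fun n => t ^ n))).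
  unfold inv_mean, hcoef; rewrite pow_O.
  field; split; apply Rgt_not_eq, INR_S_pos.
Qed.

Lemma three_weighted_sum (mu w : R) (j : nat) (F : nat -> R) :
  infinite_sum (fun n => INR n * three mu j w n * F n)
    (mu * (w * F (S j) + (1 - w) * F (S (S j)))).
Proof.
  generalize (three_sum mu w j (fun n => INR n * F n)).
  replace (_ + _) with (mu * (w * F (S j) + (1 - w) * F (S (S j)))).
  - apply infinite_sum_ext; intros n; ring.
  - change (INR 0) with 0; field; split; apply Rgt_not_eq, INR_S_pos.
Qed.

Lemma three_mean (mu w : R) (j : nat) :
  infinite_sum (fun n => INR n * three mu j w n) mu.
Proof.
  generalize (three_weighted_sum mu w j (fun _ => 1)).
  replace (mu * _) with mu by ring.
  apply infinite_sum_ext; intros n; ring.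
Qed.

Lemma fbarD_three (mu w t : R) (j : nat) : 0 < mu ->
  fbarD (three mu j w) t = w * t ^ j + (1 - w) * t ^ S j.
Proof.
  intros hmu; unfold fbarD, meanD, fD'.
  rewrite (infinite_sum_series _ _ (three_mean mu w j)).
  rewrite (infinite_sum_series _ (mu * (w * t ^ j + (1 - w) * t ^ S j))).
  { field; lra. }
  apply (infinite_sum_shift (fun n => INR n * three mu j w n * t ^ pred n)).
  - simpl; ring.
  - apply three_weighted_sum.
Qed.

Lemma three_in_B (mu w : R) (j : nat) : 0 < mu -> feasible mu j w ->
  in_B mu (three mu j w).
Proof.
  intros hmu [Hw Hf]; split; [split|apply three_mean].
  - intros n; unfold three.
    assert (Hq : forall m v, 0 <= v -> 0 <= mu * v / INR (S m)).
    { intros m v Hv; apply Rmult_le_pos; [nra|].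
      left; apply Rinv_0_lt_compat, INR_S_pos. }
    assert (0 <= mu * w / INR (S j)) by (apply Hq; lra).
    assert (0 <= mu * (1 - w) / INR (S (S j))) by (apply Hq; lra).
    destruct (Nat.eqb n 0), (Nat.eqb n (S j)), (Nat.eqb n (S (S j))); lra.
  - generalize (three_sum mu w j (fun _ => 1)).
    replace (_ + _) with 1.
    + apply infinite_sum_ext; intros n; ring.
    + unfold inv_mean; field; split; apply Rgt_not_eq, INR_S_pos.
Qed.

Lemma three_total (mu w : R) (j : nat) :
  three mu j w 0 + three mu j w (S j) + three mu j w (S (S j)) = 1.
Proof.
  unfold three; rewrite !Nat.eqb_refl; simpl Nat.eqb.
  replace (Nat.eqb j (S j)) with false by (symmetry; apply Nat.eqb_neq; lia).
  replace (Nat.eqb match j with 0%nat => 0%nat | S _ => j end j) with true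
    by (symmetry; apply Nat.eqb_eq; destruct j; lia).
  replace (match j with 0%nat => false | S m' => Nat.eqb j m' end) with false
    by (destruct j; [reflexivity|symmetry; apply Nat.eqb_neq; lia]).
  unfold inv_mean; field; split; apply Rgt_not_eq, INR_S_pos.
Qed.

Lemma inv_mean_bounds (j : nat) (w : R) : 0 <= w <= 1 ->
  / INR (S (S j)) <= inv_mean j w <= / INR (S j).
Proof.
  intros Hw; unfold inv_mean, Rdiv.
  assert (/ INR (S (S j)) <= / INR (S j)); [|nra].
  apply Rinv_le_contravar; [apply INR_S_pos|apply le_INR; lia].
Qed.

Lemma exists_nat_floor (x : R) : 1 <= x -> exists j, INR (S j) <= x < INR (S (S j)).
Proof.
  intros Hx; destruct (INR_unbounded x) as [n Hn].
  induction n as [|n IH]; [simpl in Hn; lra|].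
  destruct (Rlt_le_dec x (INR n)) as [H|H]; [now apply IH|].
  destruct n as [|j]; [simpl in Hn; lra|now exists j].
Qed.

Lemma exists_saturated (mu : R) : 1 <= mu ->
  exists j w, 0 <= w <= 1 /\ mu * inv_mean j w = 1.
Proof.
  intros Hmu; destruct (exists_nat_floor mu Hmu) as [j Hj].
  generalize (INR_S_pos j); intros Hp.
  (* The law on k = j + 1 and k + 1 with mean mu and no mass at 0 has P(k) = k + 1 - mu; its
     size-biased weight at k is w = k (k + 1 - mu) / mu. *)
  exists j, (INR (S j) * (INR (S (S j)) - mu) / mu).
  rewrite (S_INR (S j)) in *; set (k := INR (S j)) in *.
  split; [split|].
  - apply Rmult_le_pos; [nra|left; apply Rinv_0_lt_compat; lra].
  - apply Rmult_le_reg_r with mu; [lra|].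
    unfold Rdiv; rewrite Rmult_assoc, Rinv_l; nra.
  - unfold inv_mean; rewrite (S_INR (S j)); fold k; field; lra.
Qed.

Lemma exists_feasible (mu : R) : 0 < mu -> exists j w, feasible mu j w.
Proof.
  intros hmu; destruct (Rle_lt_dec 1 mu) as [H|H].
  - destruct (exists_saturated mu H) as [j [w [Hw E]]].
    exists j, w; split; lra.
  (* For mu < 1: mass mu at 1 and 1 - mu at 0. *)
  - exists 0%nat, 1; split; [lra|]; unfold inv_mean; simpl; lra.
Qed.

(** * Comparison of an arbitrary law with a three-point law *)

(** The chord bound for [hcoef], weighted by n P n and summed, bounds 1 - f(t) by a combination of
    mu and f'(t). The three-point law has the same mu and f'(t) and attains equality, being carried
    by the nodes of the chord. *)
Lemma fD_ge_chord (mu t w : R) (j : nat) (P : nat -> R) :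
  0 < mu -> in_B mu P -> 0 <= t < 1 -> 0 < t ^ j ->
  fbarD P t = w * t ^ j + (1 - w) * t ^ S j ->
  fD (three mu j w) t <= fD P t.
Proof.
  intros hmu HP Ht Hj Hz.
  destruct (hcoef_le_chord t j Ht Hj) as [A [B [E1 [E2 HAB]]]].
  assert (Hf' : fD' P t = mu * (w * t ^ j + (1 - w) * t ^ S j)).
  { rewrite <- Hz; unfold fbarD; rewrite (meanD_in_B mu P HP); field; lra. }
  rewrite fD_three, E1, E2.
  replace (1 - _) with (1 + (- A * mu + - B * fD' P t)) by (rewrite Hf'; ring).
  refine (infinite_sum_le
    (fun n => P n + (- A * (INR n * P n) + - B * (INR n * P n * t ^ pred n)))
    (fun n => P n * t ^ n) _ _ _ _ _).
  - intros n; generalize (law_nonneg mu P HP n); intros Hn.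
    destruct n as [|n]; [simpl; lra|].
    generalize (HAB n) (INR_S_pos n); unfold hcoef; intros H Hp; simpl pred.
    apply (Rmult_le_compat_r (INR (S n))) in H; [|lra].
    unfold Rdiv in H; rewrite Rmult_assoc, Rinv_l in H by lra.
    assert (P (S n) * (1 - t ^ S n) <= P (S n) * ((A + B * t ^ n) * INR (S n)))
      by (apply Rmult_le_compat_l; lra).
    lra.
  - apply infinite_sum_plus; [apply HP|].
    apply infinite_sum_plus; apply infinite_sum_scal; [apply HP|].
    apply (fD'_sum mu); [exact HP|lra].
  - apply (fD_sum mu); [exact HP|lra].
Qed.

(** Without mass at 0 the law sits on j + 1 and j + 2, where n |-> t^n meets its chord. The chord is
    affine in n, so its mean depends on mu alone, and convexity concludes. *)
Lemma fD_saturated_le (mu t w : R) (j : nat) (P : nat -> R) :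
  in_B mu P -> 0 <= t <= 1 -> mu * inv_mean j w = 1 ->
  fD (three mu j w) t <= fD P t.
Proof.
  intros HP Ht Hs.
  set (k := INR (S j)).
  set (c := t ^ S (S j) - t ^ S j).
  assert (Hk : 0 < k) by apply INR_S_pos.
  assert (E : fD (three mu j w) t = (t ^ S j - k * c) * 1 + c * mu).
  { rewrite fD_three; unfold hcoef, inv_mean in *; unfold c.
    rewrite (S_INR (S j)) in *; fold k in Hs |- *.
    (* Saturation cleared of denominators, which determines [mu * w]. *)
    assert (E : mu * (k + w) = k * (k + 1)).
    { transitivity (k * (k + 1) * (mu * (w / k + (1 - w) / (k + 1))));
        [field; lra|rewrite Hs; ring]. }
    assert (Ew : mu * w = k * (k + 1 - mu)) by lra.
    replace (1 - _) with
      (1 - (mu * w) * ((1 - t ^ S j) / k) - (mu - mu * w) * ((1 - t ^ S (S j)) / (k + 1)))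
      by ring.
    rewrite Ew; field; lra. }
  rewrite E.
  refine (infinite_sum_le (fun n => (t ^ S j - k * c) * P n + c * (INR n * P n))
    (fun n => P n * t ^ n) _ _ _ _ _).
  - intros n; generalize (pow_ge_chord t (S j) n Ht) (law_nonneg mu P HP n).
    fold k c; intros H Hn.
    apply (Rmult_le_compat_l (P n)) in H; [lra|exact Hn].
  - apply infinite_sum_plus; apply infinite_sum_scal; apply HP.
  - now apply (fD_sum mu).
Qed.

Lemma pow_bracket (t z : R) : 0 < t < 1 -> 0 < z <= 1 ->
  exists j, t ^ S j <= z <= t ^ j.
Proof.
  intros Ht Hz.
  destruct (pow_lt_1_zero t) with (y := z) as [N HN]; [rewrite Rabs_pos_eq; lra|lra|].
  assert (HNz : t ^ N < z).
  { rewrite <- (Rabs_pos_eq (t ^ N)); [apply HN; lia|apply pow_le; lra]. }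
  clear HN; induction N as [|N IH]; [simpl in HNz; lra|].
  destruct (Rlt_le_dec (t ^ N) z) as [H|H]; [now apply IH|].
  exists N; lra.
Qed.

(* Both sides lie on the curve of laws carried by two consecutive integers,
   along which 1/n and t^n have monotone means. *)
Lemma two_point_mono (t w v : R) (i j : nat) : 0 <= t <= 1 ->
  0 <= w <= 1 -> 0 <= v <= 1 -> inv_mean j w < inv_mean i v ->
  w * t ^ j + (1 - w) * t ^ S j <= v * t ^ i + (1 - v) * t ^ S i.
Proof.
  intros Ht Hw Hv H.
  assert (Hpow : forall a b, (a <= b)%nat -> t ^ b <= t ^ a).
  { intros a b Hab; replace b with (a + (b - a))%nat by lia; rewrite pow_add.
    generalize (pow_unit t a Ht) (pow_unit t (b - a) Ht); intros Ha Hb.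
    rewrite <- (Rmult_1_r (t ^ a)) at 2; apply Rmult_le_compat_l; lra. }
  assert (Hj : t ^ S j <= t ^ j) by (apply Hpow; lia).
  assert (Hi : t ^ S i <= t ^ i) by (apply Hpow; lia).
  destruct (Nat.lt_trichotomy i j) as [Hij|[->|Hij]].
  (* For i < j the power t^(i+1) separates the two sides. *)
  - assert (t ^ j <= t ^ S i) by (apply Hpow; lia); nra.
  - assert (w <= v); [|nra].
    unfold inv_mean, Rdiv in H.
    assert (/ INR (S (S j)) < / INR (S j)); [|nra].
    apply Rinv_lt_contravar; [|apply lt_INR; lia].
    apply Rmult_lt_0_compat; apply INR_S_pos.
  (* For j < i the means of 1/n are ordered the other way, against the hypothesis. *)
  - generalize (inv_mean_bounds j w Hw) (inv_mean_bounds i v Hv); intros Bj Bi.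
    assert (Hle : / INR (S i) <= / INR (S (S j)))
      by (apply Rinv_le_contravar; [apply INR_S_pos|apply le_INR; lia]).
    lra.
Qed.
Lemma exists_better_three (mu p : R) (P : nat -> R) :
  0 < mu -> 0 < p <= 1 -> in_B mu P ->
  exists j w, feasible mu j w /\ qDp (three mu j w) p <= qDp P p.
Proof.
  intros hmu hp HP.
  destruct (zDp_smallest_root mu P hmu HP p hp) as [Hz01 [Hz _]].
  assert (Hq : qDp P p = gDp P p (zDp P p)) by reflexivity.
  set (z := zDp P p) in *; clearbody z.
  set (t := 1 - p + p * z).
  assert (Ht : 0 <= t <= 1) by (unfold t; nra).
  assert (Hbelow : forall j w, feasible mu j w ->
     w * t ^ j + (1 - w) * t ^ S j <= z -> fD (three mu j w) t <= fD P t ->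
     qDp (three mu j w) p <= qDp P p).
  { intros j w Hf Hg Hle; rewrite Hq.
    apply Rle_trans with (gDp (three mu j w) p z); [|exact Hle].
    apply (qDp_le mu); auto using three_in_B.
    unfold gbarDp; rewrite fbarD_three by exact hmu; exact Hg. }
  (* If t = 1 then q = 1, and any feasible law does at least as well. *)
  destruct (Req_dec t 1) as [Ht1|Ht1].
  { destruct (exists_feasible mu hmu) as [j [w Hf]]; exists j, w; split; [exact Hf|].
    rewrite Hq; unfold gDp; fold t; rewrite Ht1, (fD_one mu P HP).
    apply (qDp_le_one mu); auto using three_in_B. }
  assert (Hbr : exists j, 0 < t ^ j /\ t ^ S j <= z <= t ^ j).
  { destruct (Req_dec t 0) as [Ht0|Ht0].
    (* Here t = 0 forces p = 1 and z = 0, so z = t^1 and j = 0 brackets it. *)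
    - exists 0%nat; rewrite Ht0; simpl; unfold t in Ht0; split; nra.
    - assert (Hzpos : 0 < z).
      { rewrite <- Hz; unfold gbarDp; fold t; apply (fbarD_pos mu P hmu HP); lra. }
      destruct (pow_bracket t z) as [j Hj]; [lra|lra|].
      exists j; split; [apply pow_lt; lra|exact Hj]. }
  destruct Hbr as [j [Hj Hjz]].
  assert (Hgap : 0 < t ^ j - t ^ S j) by (simpl pow; nra).
  (* The weight that keeps z a fixed point. *)
  set (w := (z - t ^ S j) / (t ^ j - t ^ S j)).
  assert (Hw : 0 <= w <= 1).
  { unfold w; split.
    - apply Rmult_le_pos; [lra|left; now apply Rinv_0_lt_compat].
    - apply Rmult_le_reg_r with (t ^ j - t ^ S j); [exact Hgap|].
      unfold Rdiv; rewrite Rmult_assoc, Rinv_l; lra. }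
  assert (Ez : w * t ^ j + (1 - w) * t ^ S j = z).
  { unfold w; field; lra. }
  destruct (Rle_lt_dec (mu * inv_mean j w) 1) as [Hf|Hf].
  - exists j, w; assert (Hfe : feasible mu j w) by now split.
    split; [exact Hfe|]; apply Hbelow; [exact Hfe|lra|].
    apply fD_ge_chord; auto; [lra|].
    rewrite Ez; exact Hz.
  (* The mass at 0 would be negative. The saturated law has a smaller mean of 1/n, hence a smaller
     fbar at t, so z still satisfies gbar z <= z for it. *)
  - assert (Hmu : 1 <= mu).
    { assert (inv_mean j w <= 1); [|nra].
      apply Rle_trans with (1 := proj2 (inv_mean_bounds j w Hw)).
      rewrite <- Rinv_1; apply Rinv_le_contravar; [lra|].
      rewrite S_INR; generalize (pos_INR j); lra. }
    destruct (exists_saturated mu Hmu) as [i [v [Hv Hs]]].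
    exists i, v; assert (Hfe : feasible mu i v) by (split; lra).
    split; [exact Hfe|]; apply Hbelow; [exact Hfe| |].
    + rewrite <- Ez; apply two_point_mono; auto.
      apply Rmult_lt_reg_l with mu; lra.
    + now apply fD_saturated_le.
Qed.

(** * Attainment of the minimum among three-point laws *)

(** Direct method: a minimizing sequence has a cluster point in [a, b], and lower semicontinuity
    there forces the value to be the infimum. *)
Lemma lower_semicontinuous_min (m : R -> R) (a b : R) :
  a <= b -> (forall x, a <= x <= b -> 0 <= m x) ->
  (forall x eps, a <= x <= b -> 0 < eps ->
     exists delta, 0 < delta /\
       forall y, a <= y <= b -> Rabs (y - x) < delta -> m x - eps < m y) ->
  exists x, a <= x <= b /\ forall y, a <= y <= b -> m x <= m y.
Proof.
  intros Hab Hpos Hlsc.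
  set (E := fun v => exists x, a <= x <= b /\ v = - m x).
  destruct (completeness E) as [M [Hub Hlub]].
  { exists 0; intros v [x [Hx ->]]; generalize (Hpos x Hx); lra. }
  { exists (- m a), a; split; [lra|reflexivity]. }
  assert (Hseq : forall n : nat, exists x, a <= x <= b /\ m x < - M + / INR (S n)).
  { intros n; apply NNPP; intros Hno.
    assert (Hi : 0 < / INR (S n)) by apply Rinv_0_lt_compat, INR_S_pos.
    assert (M <= M - / INR (S n)); [|lra].
    apply Hlub; intros v [x [Hx ->]].
    destruct (Rlt_le_dec (m x) (- M + / INR (S n))) as [H|H]; [|lra].
    exfalso; apply Hno; now exists x. }
  set (u := fun n => proj1_sig (constructive_indefinite_description _ (Hseq n))).
  assert (Hu : forall n, a <= u n <= b /\ m (u n) < - M + / INR (S n)).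
  { intros n; unfold u; apply proj2_sig. }
  destruct (Bolzano_Weierstrass u (fun x => a <= x <= b) (compact_P3 a b))
    as [l Hl]; [intros n; apply Hu|].
  assert (Hnear : forall d N, 0 < d -> exists n, (N <= n)%nat /\ Rabs (u n - l) < d).
  { intros d N Hd; apply (Hl (fun x => Rabs (x - l) < d) N).
    exists (mkposreal d Hd); intros x Hx; exact Hx. }
  assert (Hlab : a <= l <= b).
  { split; apply Rnot_lt_le; intros H.
    - destruct (Hnear (a - l) 0%nat) as [n [_ Hn]]; [lra|].
      apply Rabs_def2 in Hn; generalize (proj1 (Hu n)); lra.
    - destruct (Hnear (l - b) 0%nat) as [n [_ Hn]]; [lra|].
      apply Rabs_def2 in Hn; generalize (proj1 (Hu n)); lra. }
  exists l; split; [exact Hlab|]; intros y Hy.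
  apply Rnot_lt_le; intros Hlt.
  assert (- m y <= M) by (apply Hub; now exists y).
  (* The infimum is [- M]; half of the gap goes to semicontinuity, half to the error 1/(n+1) of the
     sequence. *)
  set (eps := (m l + M) / 2).
  assert (Heps : 0 < eps) by (unfold eps; lra).
  destruct (Hlsc l eps Hlab Heps) as [d [Hd Hd']].
  destruct (archimed_cor1 eps Heps) as [N [HN HN0]].
  destruct (Hnear d N Hd) as [n [Hn Hnd]].
  generalize (Hd' (u n) (proj1 (Hu n)) Hnd) (proj2 (Hu n)).
  assert (/ INR (S n) <= / INR N).
  { apply Rinv_le_contravar; [now apply lt_0_INR|apply le_INR; lia]. }
  unfold eps in *; lra.
Qed.

(** With k = j + 1, [inv_mean j w] is (k + w)/(k (k + 1)); solving for w shows that the feasible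
    weights fill a compact segment, possibly empty. *)
Lemma feasible_iff (mu w : R) (j : nat) : 0 < mu ->
  feasible mu j w <-> 0 <= w <= Rmin 1 (INR (S j) * INR (S (S j)) / mu - INR (S j)).
Proof.
  intros hmu; unfold feasible, inv_mean.
  generalize (INR_S_pos j); rewrite (S_INR (S j)); set (k := INR (S j)); intros Hk.
  assert (E : mu * (w / k + (1 - w) / (k + 1)) <= 1 <-> w <= k * (k + 1) / mu - k).
  { replace (mu * (w / k + (1 - w) / (k + 1)))
      with (1 - mu / (k * (k + 1)) * (k * (k + 1) / mu - k - w)) by (field; lra).
    assert (0 < mu / (k * (k + 1))).
    { apply Rdiv_lt_0_compat; [exact hmu|apply Rmult_lt_0_compat; lra]. }
    split; nra. }
  rewrite E; unfold Rmin; destruct (Rle_dec _ _); lra.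
Qed.

(** Here q = Q v (z v), where Q is Lipschitz in the weight, continuous in s and nondecreasing in s
    on [0, 1]. An upward jump of the root can only raise q, so only downward moves need control. *)
Lemma qDp_three_lsc (mu p w eps : R) (j : nat) :
  0 < mu -> 0 < p <= 1 -> feasible mu j w -> 0 < eps ->
  exists delta, 0 < delta /\
    forall v, feasible mu j v -> Rabs (v - w) < delta ->
      qDp (three mu j w) p - eps < qDp (three mu j v) p.
Proof.
  intros hmu hp Hw Heps.
  set (tau := fun s => 1 - p + p * s).
  set (Q := fun v s => 1 - mu * (v * hcoef (tau s) j + (1 - v) * hcoef (tau s) (S j))).
  assert (HQ : forall v, qDp (three mu j v) p = Q v (zDp (three mu j v) p)).
  { intros v; unfold qDp, gDp, Q; now rewrite fD_three. }
  assert (Hroot : forall v, feasible mu j v ->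
            is_smallest_root (three mu j v) p (zDp (three mu j v) p)).
  { intros v Hv; apply (zDp_smallest_root mu); auto using three_in_B. }
  rewrite HQ; set (z := zDp (three mu j w) p).
  assert (Hz : 0 <= z <= 1) by apply (Hroot w Hw).
  assert (Hcont : continuity_pt (Q w) z).
  { unfold Q, hcoef, tau; reg; apply Rgt_not_eq, INR_S_pos. }
  destruct (Hcont (eps / 2)) as [d [Hd Hdz]]; [lra|].
  assert (HQz : forall s, z - d < s < z + d -> Q w z - eps / 2 < Q w s).
  { intros s Hs; destruct (Req_dec s z) as [->|Hsz]; [lra|].
    assert (H : Rabs (Q w s - Q w z) < eps / 2).
    { apply Hdz; split; [split; [exact I|auto]|].
      apply Rabs_def1; simpl; lra. }
    apply Rabs_def2 in H; lra. }
  (* the roots can only jump upwards under a small change of [w] *)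
  assert (Hzlow : exists e, 0 < e /\
     forall v, feasible mu j v -> Rabs (v - w) < e -> z - d < zDp (three mu j v) p).
  { set (G := fun s => w * tau s ^ j + (1 - w) * tau s ^ S j - s).
    destruct (Rlt_le_dec (z - d) 0) as [Ha|Ha].
    { exists 1; split; [lra|]; intros v Hv _.
      generalize (proj1 (Hroot v Hv)); lra. }
    destruct (continuity_ab_min G 0 (z - d) Ha) as [s0 [Hmin Hs0]].
    { intros c _; unfold G, tau; reg. }
    (* G s0 <= 0 would make s0 < z satisfy gbar s0 <= s0, against the minimality of z. *)
    assert (Hpos : 0 < G s0).
    { apply Rnot_le_lt; intros Hle.
      assert (z <= s0); [|lra].
      apply (zDp_le mu); auto using three_in_B; [lra|].
      unfold gbarDp; rewrite fbarD_three by exact hmu; unfold G, tau in Hle; lra. }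
    exists (G s0); split; [exact Hpos|]; intros v Hv Hvw.
    apply Rnot_le_lt; intros Hle.
    destruct (Hroot v Hv) as [Hy [Ey _]].
    set (y := zDp (three mu j v) p) in *.
    unfold gbarDp in Ey; rewrite fbarD_three in Ey by exact hmu.
    assert (HG : G s0 <= G y) by (apply Hmin; lra).
    assert (Hty : 0 <= tau y <= 1) by (unfold tau; nra).
    generalize (pow_unit (tau y) j Hty); intros Hp.
    (* Since y is a root for v, G y only measures the change of weight and is at most |v - w| in
       size, too small to reach the minimum of G on [0, z - d]. *)
    assert (EG : G y = (w - v) * (tau y ^ j * (1 - tau y))).
    { unfold G; unfold tau in *; simpl pow in *; lra. }
    assert (0 <= tau y ^ j * (1 - tau y) <= 1) by nra.
    apply Rabs_def2 in Hvw; nra. }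
  destruct Hzlow as [e [He Hze]].
  exists (Rmin e (eps / (2 * mu))); split.
  { apply Rmin_pos; [exact He|apply Rdiv_lt_0_compat; lra]. }
  intros v Hv Hvw; rewrite HQ.
  assert (Hvw1 : Rabs (v - w) < e) by (apply Rlt_le_trans with (1 := Hvw), Rmin_l).
  assert (Hvw2 : Rabs (v - w) < eps / (2 * mu))
    by (apply Rlt_le_trans with (1 := Hvw), Rmin_r).
  generalize (Hze v Hv Hvw1) (proj1 (Hroot v Hv)).
  set (y := zDp (three mu j v) p); intros Hzy Hy.
  assert (Hty : 0 <= tau y <= 1) by (unfold tau; nra).
  (* Continuity handles y near z, monotonicity in s the roots that jumped above z + d. *)
  assert (HQy : Q w z - eps / 2 < Q w y).
  { destruct (Rlt_le_dec y (z + d)) as [H|H]; [apply HQz; lra|].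
    apply Rlt_le_trans with (Q w z); [lra|].
    unfold Q; rewrite <- !fD_three.
    apply (fD_incr mu); [auto using three_in_B| | |]; unfold tau in *; nra. }
  assert (EQ : Q v y - Q w y
               = (v - w) * (mu * (hcoef (tau y) (S j) - hcoef (tau y) j)))
    by (unfold Q; ring).
  generalize (hcoef_unit (tau y) j Hty) (hcoef_unit (tau y) (S j) Hty).
  set (x := hcoef (tau y) (S j) - hcoef (tau y) j) in *; intros H1 H2.
  assert (Hx : Rabs x <= 1) by (apply Rabs_le; unfold x; lra).
  assert (Hd2 : Rabs (Q v y - Q w y) <= mu * Rabs (v - w)).
  { rewrite EQ, !Rabs_mult, (Rabs_pos_eq mu) by lra.
    generalize (Rabs_pos (v - w)); intros Hp.
    assert (Rabs (v - w) * Rabs x <= Rabs (v - w) * 1)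
      by (apply Rmult_le_compat_l; lra).
    nra. }
  assert (Hd3 : mu * Rabs (v - w) < eps / 2).
  { replace (eps / 2) with (mu * (eps / (2 * mu))) by (field; lra).
    now apply Rmult_lt_compat_l. }
  assert (Hd4 : Rabs (Q v y - Q w y) < eps / 2) by lra.
  apply Rabs_def2 in Hd4; lra.
Qed.

(** q is at least the mass at 0. This gives both q >= 0 for the minimization on one segment and q >=
    1 - mu/(j + 1) for large supports. *)
Lemma qDp_three_ge (mu p w : R) (j : nat) : 0 < mu -> 0 < p <= 1 -> feasible mu j w ->
  1 - mu * inv_mean j w <= qDp (three mu j w) p.
Proof.
  intros hmu hp Hf.
  destruct (zDp_smallest_root mu (three mu j w) hmu (three_in_B mu w j hmu Hf) p hp)
    as [Hz _].
  unfold qDp, gDp; rewrite fD_three.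
  set (t := 1 - p + p * _).
  assert (Ht : 0 <= t <= 1) by (unfold t; nra).
  assert (Hh : forall n, hcoef t n <= / INR (S n)).
  { intros n; unfold hcoef, Rdiv; rewrite <- (Rmult_1_l (/ _)) at 2.
    apply Rmult_le_compat_r; [left; apply Rinv_0_lt_compat, INR_S_pos|].
    generalize (pow_unit t (S n) Ht); lra. }
  apply Rplus_le_compat_l, Ropp_le_contravar, Rmult_le_compat_l; [lra|].
  unfold inv_mean, Rdiv; destruct Hf as [Hw _].
  apply Rplus_le_compat; apply Rmult_le_compat_l; auto; lra.
Qed.

Lemma exists_min_fixed_support (mu p w : R) (j : nat) :
  0 < mu -> 0 < p <= 1 -> feasible mu j w ->
  exists v, feasible mu j v /\
    forall x, feasible mu j x -> qDp (three mu j v) p <= qDp (three mu j x) p.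
Proof.
  intros hmu hp Hw.
  set (b := Rmin 1 (INR (S j) * INR (S (S j)) / mu - INR (S j))).
  assert (Hb : forall x, feasible mu j x <-> 0 <= x <= b)
    by (intros x; now apply feasible_iff).
  destruct (lower_semicontinuous_min (fun x => qDp (three mu j x) p) 0 b)
    as [v [Hv Hmin]].
  - apply Hb in Hw; lra.
  - intros x Hx; apply Hb in Hx.
    apply Rle_trans with (2 := qDp_three_ge mu p x j hmu hp Hx).
    destruct Hx; lra.
  - intros x eps Hx Heps; apply Hb in Hx.
    destruct (qDp_three_lsc mu p x eps j hmu hp Hx Heps) as [d [Hd H]].
    exists d; split; [exact Hd|]; intros y Hy; apply Hb in Hy; now apply H.
  - exists v; split; [now apply Hb|]; intros x Hx; now apply Hmin, Hb.
Qed.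

(** For mu > j + 2 no weight is feasible, so the induction on K carries along the existence of a
    feasible law. *)
Lemma exists_min_bounded_support (mu p : R) (K : nat) : 0 < mu -> 0 < p <= 1 ->
  (exists j w, (j < K)%nat /\ feasible mu j w) ->
  exists j w, feasible mu j w /\
    forall i v, (i < K)%nat -> feasible mu i v ->
      qDp (three mu j w) p <= qDp (three mu i v) p.
Proof.
  intros hmu hp; induction K as [|K IH]; intros [j0 [w0 [Hj0 Hw0]]]; [lia|].
  assert (HK : (exists w, feasible mu K w) \/ ~ exists w, feasible mu K w)
    by apply classic.
  destruct (classic (exists j w, (j < K)%nat /\ feasible mu j w)) as [H|H].
  - destruct (IH H) as [j [w [Hf Hmin]]].
    destruct HK as [[w1 Hw1]|HK].
    + destruct (exists_min_fixed_support mu p w1 K hmu hp Hw1) as [v [Hv Hvmin]].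
      destruct (Rle_lt_dec (qDp (three mu j w) p) (qDp (three mu K v) p)) as [Hle|Hle];
        [exists j, w|exists K, v]; (split; [assumption|]); intros i x Hi Hx;
        (destruct (Nat.eq_dec i K) as [->|Hne];
         [specialize (Hvmin x Hx)|specialize (Hmin i x ltac:(lia) Hx)]); lra.
    + exists j, w; split; [exact Hf|]; intros i x Hi Hx; apply Hmin; [|exact Hx].
      destruct (Nat.eq_dec i K) as [->|]; [|lia].
      exfalso; apply HK; now exists x.
  - assert (Hall : forall i x, (i < S K)%nat -> feasible mu i x -> i = K).
    { intros i x Hi Hx; destruct (Nat.eq_dec i K); [assumption|].
      exfalso; apply H; exists i, x; split; [lia|exact Hx]. }
    rewrite (Hall j0 w0 Hj0 Hw0) in Hw0.
    destruct (exists_min_fixed_support mu p w0 K hmu hp Hw0) as [v [Hv Hvmin]].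
    exists K, v; split; [exact Hv|]; intros i x Hi Hx.
    assert (E : i = K) by exact (Hall i x Hi Hx).
    rewrite E in *; now apply Hvmin.
Qed.

Lemma exists_min_three (mu p : R) : 0 < mu -> 0 < p <= 1 ->
  exists j w, feasible mu j w /\
    forall i v, feasible mu i v -> qDp (three mu j w) p <= qDp (three mu i v) p.
Proof.
  intros hmu hp.
  destruct (classic (exists j w, feasible mu j w /\ qDp (three mu j w) p < 1))
    as [[j [w [Hf Hq]]]|Hnone].
  - set (q := qDp (three mu j w) p) in *.
    (* Beyond this N, q is at least 1 - mu/(i + 1), hence at least the value already reached. Adding
       [S j] keeps the reference law within the finite search. *)
    destruct (INR_unbounded (mu / (1 - q))) as [N HN].
    destruct (exists_min_bounded_support mu p (N + S j) hmu hp) as [j' [w' [Hf' Hmin]]].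
    { exists j, w; split; [lia|exact Hf]. }
    exists j', w'; split; [exact Hf'|]; intros i v Hv.
    destruct (Nat.lt_ge_cases i (N + S j)) as [Hi|Hi]; [now apply Hmin|].
    apply Rle_trans with q; [apply Hmin; [lia|exact Hf]|].
    apply Rle_trans with (2 := qDp_three_ge mu p v i hmu hp Hv).
    generalize (proj2 (inv_mean_bounds i v (proj1 Hv))); intros Hinv.
    assert (HNi : mu / (1 - q) < INR (S i)).
    { apply Rlt_le_trans with (1 := HN), le_INR; lia. }
    assert (mu * / INR (S i) <= 1 - q).
    { apply Rmult_le_reg_r with (INR (S i)); [apply INR_S_pos|].
      rewrite Rmult_assoc, Rinv_l by apply Rgt_not_eq, INR_S_pos.
      replace (mu * 1) with ((1 - q) * (mu / (1 - q))) by (field; lra).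
      apply Rmult_le_compat_l; lra. }
    assert (mu * inv_mean i v <= mu * / INR (S i)) by (apply Rmult_le_compat_l; lra).
    lra.
  (* All values equal 1, so any feasible law is minimal. *)
  - destruct (exists_feasible mu hmu) as [j [w Hf]]; exists j, w; split; [exact Hf|].
    intros i v Hv.
    apply Rle_trans with 1; [apply (qDp_le_one mu); auto using three_in_B|].
    apply Rnot_lt_le; intros H; apply Hnone; now exists i, v.
Qed.

(* q* = inf_{D in B_mu} q_{D,p}; the conclusion says D* in B_mu attains it,
   i.e. q_{D*,p} <= q_{D,p} for every D in B_mu. *)
Theorem theorem4p1 (mu p : R) (hmu : 0 < mu) (hp : 0 < p <= 1) :
  exists (k : nat) (Dstar : nat -> R),
    (1 <= k)%nat /\ in_B mu Dstar /\
    Dstar 0%nat + Dstar k + Dstar (S k) = 1 /\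
    (forall D : nat -> R, in_B mu D -> qDp Dstar p <= qDp D p).
Proof.
  destruct (exists_min_three mu p hmu hp) as [j [w [Hf Hmin]]].
  exists (S j), (three mu j w); split; [lia|split; [now apply three_in_B|split]].
  - apply three_total.
  - intros D HD.
    destruct (exists_better_three mu p D hmu hp HD) as [i [v [Hv Hle]]].
    apply Rle_trans with (2 := Hle); now apply Hmin.
Qed.
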